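(* Let $T$ be a local integral domain with maximal ideal $M$, let $K := T/M$ be its residue field, let $\varphi : T \to K$ be the canonical surjection, let $D$ be a proper subring of $K$ with quotient field $k \subseteq K$, and let $R := \varphi^{-1}(D)$, where $R$ and $T$ have the same quotient field. Then $R$ has the finite $t$-basic ideal property if and only if both $T$ and $D$ have the finite $t$-basic ideal property and $k = K$.
   Context: All rings are commutative with identity; ''local'' means having a unique maximal ideal (no Noetherian hypothesis). For an integral domain $A$ with quotient field $F$ and a nonzero fractional ideal $I$ of $A$, put $I^{-1} := \{x \in F : xI \subseteq A\}$, $I_v := (I^{-1})^{-1}$, and $I_t := \bigcup J_v$, where $J$ ranges over the nonzero finitely generated $A$-submodules of $I$. For nonzero ideals $J \subseteq I$ of $A$, $J$ is a $t$-reduction of $I$ if $(JI^{n})_t = (I^{n+1})_t$ for some integer $n \ge 0$; it is a trivial $t$-reduction of $I$ if $J_t = I_t$. A nonzero ideal $I$ is $t$-basic if every $t$-reduction of $I$ is trivial. The domain $A$ has the finite $t$-basic ideal property if every nonzero finitely generated ideal of $A$ is $t$-basic. In the claim, this notion is taken in each of $R$, $T$, $D$ with respect to its own $t$-operation. The condition that $R$ and $T$ have the same quotient field holds automatically when $M \ne 0$. *)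

(* Defs.v *)
From mathcomp Require Export all_boot all_order all_algebra all_classical.

Set Implicit Arguments.
Unset Strict Implicit.
Unset Printing Implicit Defensive.

Import GRing.Theory.

Local Open Scope classical_set_scope.
Local Open Scope ring_scope.

(* A commutative ring is given as a subring A of an ambient ring E, and its    *)
(* ideals, or more generally its A-submodules, as subsets of E; a ring that is *)
(* itself a type E is the case A = setT.                                       *)

Section Ideals.
Variable E : comNzRingType.
Implicit Types A I J : set E.

Definition is_submodule A I : Prop :=
  [/\ I 0, (forall x y, I x -> I y -> I (x + y)) &
      (forall a x, A a -> I x -> I (a * x))].

Definition is_ideal A I : Prop := is_submodule A I /\ I `<=` A.

Definition nonzero_set I : Prop := exists2 x, I x & x != 0.

Definition maximal_ideal A M : Prop :=
  [/\ is_ideal A M, M `<` A &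
      forall J, is_ideal A J -> M `<=` J -> J `<` A -> J = M].

Definition local_with_maximal_ideal A M : Prop :=
  maximal_ideal A M /\ forall N, maximal_ideal A N -> N = M.

Definition span_set A n (g : 'I_n -> E) : set E :=
  [set x | exists2 c : 'I_n -> E, (forall i, A (c i)) &
           x = \sum_(i < n) c i * g i].

Definition finitely_generated A I : Prop :=
  exists n (g : 'I_n -> E), I = span_set A g.

Definition set_mul I J : set E :=
  [set x | exists n (a b : 'I_n -> E),
     [/\ forall i, I (a i), forall i, J (b i) &
         x = \sum_(i < n) a i * b i]].

Definition set_exp A I n : set E := iter n (set_mul I) A.

End Ideals.

(* Here A is a subring of a field F, which may be larger than the quotient     *)
(* field of A: the latter is computed inside F.                                *)

Section TOperation.
Variable F : fieldType.
Implicit Types A I J : set F.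

Definition quotient_field A : set F :=
  [set x | exists a b, [/\ A a, A b, b != 0 & x = a / b]].

Definition frac_inv A I : set F :=
  [set x | quotient_field A x /\ forall y, I y -> A (x * y)].

Definition v_closure A I : set F := frac_inv A (frac_inv A I).

Definition t_closure A I : set F :=
  \bigcup_(J in [set J | [/\ finitely_generated A J, nonzero_set J & J `<=` I]])
     v_closure A J.

Definition t_reduction A J I : Prop :=
  [/\ is_ideal A J, nonzero_set J, J `<=` I &
      exists n, t_closure A (set_mul J (set_exp A I n)) =
                t_closure A (set_exp A I n.+1)].

Definition t_basic A I : Prop :=
  forall J, t_reduction A J I -> t_closure A J = t_closure A I.

Definition finite_t_basic_ideal_property A : Prop :=
  forall I, is_ideal A I -> nonzero_set I -> finitely_generated A I ->
    t_basic A I.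

End TOperation.

(* A subset of T, viewed inside the quotient field of T. *)
Definition in_frac (T : idomainType) (A : set T) : set {fraction T} :=
  @FracField.tofrac T @` A.

(* Main.v *)
Require Import Defs.
From mathcomp Require Import all_boot all_order all_algebra all_classical.

Set Implicit Arguments.
Unset Strict Implicit.
Unset Printing Implicit Defensive.

Import GRing.Theory.

Local Open Scope classical_set_scope.
Local Open Scope ring_scope.

(* The inverses, hence the t-operation, of finitely generated fractional
   ideals are residuals of finite sets of generators, so t-basicness becomes:
   if J is contained in I and (J I^n)^-1 is contained in (I^(n+1))^-1, then
   J^-1 is contained in I^-1. For a finitely generated R-module I there are
   two cases. If IT is not principal, then x I T, for x in (T : I), is a
   proper ideal of T, so it lies in M; hence I has the same inverse over R,
   over T and in M, and the condition is the one over T. If IT is principal,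
   rescale so that 1 is in I and I is in T: then I, and every J that contains
   a unit of T, contains M, and the condition descends to D. If y in T has a
   residue outside the quotient field of D, then (1, y)^-1 = M = (1, y)^-2
   over R, and (1) is a nontrivial t-reduction of (1, y). *)

(** * Residuals by finite sequences of field elements *)

Section Residual.
Variable F : fieldType.
Implicit Types (A X Y : set F) (s t : seq F).

(** This is the colon of [X] by [s]. No ring of scalars enters, so one sequence can serve as
    generators over both $R$ and $T$. *)
Definition residual s X : set F := [set x | forall a, a \in s -> X (x * a)].

(** Since $((X : I) : J) = (X : IJ)$, iterating gives the colon by an $n$-th power without forming
    products of ideals. *)
Definition residual_power s n X : set F := iter n (residual s) X.

Lemma residual_subset s t X : {subset s <= t} -> residual t X `<=` residual s X.
Proof. by move=> st x tx a /st /tx. Qed.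

Lemma residualS s X Y : X `<=` Y -> residual s X `<=` residual s Y.
Proof. by move=> XY x sx a /sx /XY. Qed.

Lemma residual_power_subset s t n X :
  {subset s <= t} -> residual_power t n X `<=` residual_power s n X.
Proof.
move=> st; elim: n => //= n IHn x /(residual_subset st); exact: residualS.
Qed.

Lemma residual_powerS s n X Y :
  X `<=` Y -> residual_power s n X `<=` residual_power s n Y.
Proof. by move=> XY; elim: n => //= n IHn; apply: residualS. Qed.

Lemma residual_powerSr s n X :
  residual_power s n.+1 X = residual_power s n (residual s X).
Proof. exact: iterSr. Qed.

Lemma residual_map_mul c s X x :
  residual [seq c * a | a <- s] X x <-> residual s X (x * c).
Proof.
split=> h a sa; first by rewrite -mulrA; apply/h/map_f.
by case/mapP: sa => b sb ->; rewrite mulrA; apply: h.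
Qed.

Lemma residual_power_map_mul c s n X x :
  residual_power [seq c * a | a <- s] n X x <->
  residual_power s n X (x * c ^+ n).
Proof.
elim: n x => [|n IHn] x; first by rewrite mulr1.
split=> /= h a sa.
  rewrite exprS mulrA mulrAC; apply/IHn.
  by rewrite -mulrA; apply/h/map_f.
case/mapP: sa => b sb ->; apply/IHn.
by rewrite mulrA -mulrA [b * _]mulrC mulrA -[x * c * _]mulrA -exprS; apply: h.
Qed.

(** Here [s] generates $J$ and [t] generates $I$, both possibly fractional. Asking for inclusion of
    the sequences rather than of the modules is no loss: [s] can be appended to [t]. *)
Definition residual_basic A : Prop :=
  forall s t n, {subset s <= t} -> has (fun a => a != 0) s ->
  residual s (residual_power t n A) `<=` residual_power t n.+1 A ->
  residual s A `<=` residual t A.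

(** The condition is homogeneous: replacing $I$ and $J$ by $cI$ and $cJ$ multiplies both sides by
    $c^{-(n+1)}$. *)
Lemma residual_basic_scale A c s t n : c != 0 ->
  residual s (residual_power t n A) `<=` residual_power t n.+1 A ->
  residual [seq c * a | a <- s] (residual_power [seq c * a | a <- t] n A) `<=`
    residual_power [seq c * a | a <- t] n.+1 A.
Proof.
move=> c0 h x hx; apply/residual_power_map_mul/h => a sa.
rewrite exprS mulrA mulrAC; apply/residual_power_map_mul.
by rewrite -mulrA; apply/hx/map_f.
Qed.

Lemma residual_subset_scale A c s t : c != 0 ->
  residual [seq c * a | a <- s] A `<=` residual [seq c * a | a <- t] A ->
  residual s A `<=` residual t A.
Proof.
move=> c0 h x sx; rewrite -[x](divfK c0); apply/residual_map_mul/h.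
by apply/residual_map_mul; rewrite divfK.
Qed.

End Residual.

(** * Submodules over a subring, their spans, products and powers *)

Section Subring.
Variables (F : fieldType) (A : set F).
Hypothesis A_subring : GRing.subring_closed [in A].

Lemma subring_set1 : A 1.
Proof. by case: A_subring => h _ _; move: h; rewrite inE. Qed.

Lemma subring_setB x y : A x -> A y -> A (x - y).
Proof.
by case: A_subring => _ h _ Ax Ay; have := h x y; rewrite !inE; apply.
Qed.

Lemma subring_setM x y : A x -> A y -> A (x * y).
Proof.
by case: A_subring => _ _ h Ax Ay; have := h x y; rewrite !inE; apply.
Qed.

Lemma subring_set0 : A 0.
Proof. by rewrite -(subrr 1); apply: subring_setB; apply: subring_set1. Qed.

Lemma subring_setD x y : A x -> A y -> A (x + y).
Proof.
move=> Ax Ay; rewrite -[y]opprK; apply: subring_setB => //.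
by rewrite -[- y]add0r; apply: subring_setB => //; apply: subring_set0.
Qed.

Lemma subring_is_submodule : is_submodule A A.
Proof.
split; [exact: subring_set0 | exact: subring_setD | exact: subring_setM].
Qed.

Lemma submodule_sum I n (f : 'I_n -> F) :
  is_submodule A I -> (forall i, I (f i)) -> I (\sum_i f i).
Proof. by move=> [I0 ID _] If; elim/big_ind: _ => // i _. Qed.

Lemma span_set_min I n (g : 'I_n -> F) :
  is_submodule A I -> (forall i, I (g i)) -> span_set A g `<=` I.
Proof.
move=> I_mod Ig _ [c Ac ->]; apply: submodule_sum => // i.
by case: I_mod => _ _; apply.
Qed.

Lemma span_set_submodule n (g : 'I_n -> F) : is_submodule A (span_set A g).
Proof.
split.
- exists (fun=> 0) => [_|]; first exact: subring_set0.
  by rewrite big1 // => i _; rewrite mul0r.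
- move=> _ _ [c Ac ->] [d Ad ->]; exists (fun i => c i + d i).
    by move=> i; apply: subring_setD.
  by rewrite -big_split; apply: eq_bigr => i _; rewrite mulrDl.
- move=> a _ Aa [c Ac ->]; exists (fun i => a * c i).
    by move=> i; apply: subring_setM.
  by rewrite mulr_sumr; apply: eq_bigr => i _; rewrite mulrA.
Qed.

Lemma mem_span_set n (g : 'I_n -> F) i : span_set A g (g i).
Proof.
exists (fun j => (j == i)%:R) => [j|].
  by case: (j == i); [apply: subring_set1 | apply: subring_set0].
rewrite (bigD1 i) //= eqxx mul1r big1 ?addr0 // => j /negPf ->.
by rewrite mul0r.
Qed.

Lemma residual_submodule s X : is_submodule A X -> is_submodule A (residual s X).
Proof.
move=> [X0 XD XM]; split=> [a _|x y sx sy a sa|a x Aa sx b sb].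
- by rewrite mul0r.
- by rewrite mulrDl; apply: XD; [apply: sx | apply: sy].
- by rewrite -mulrA; apply: XM => //; apply: sx.
Qed.

Lemma residual_power_submodule s n X :
  is_submodule A X -> is_submodule A (residual_power s n X).
Proof. by move=> X_mod; elim: n => //= n; apply: residual_submodule. Qed.

Lemma set_mul_submodule (I J : set F) :
  is_submodule A I -> is_submodule A (set_mul I J).
Proof.
move=> [I0 ID IM]; split.
- by exists 0%N, (fun=> 0), (fun=> 0); split=> [[]|[]|] //; rewrite big_ord0.
- move=> _ _ [m [a [b [Ia Jb ->]]]] [n [c [d [Ic Jd ->]]]].
  exists (m + n)%N,
    (fun i : 'I_(m + n) =>
       match fintype.split i with inl j => a j | inr j => c j end),
    (fun i : 'I_(m + n) =>
       match fintype.split i with inl j => b j | inr j => d j end).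
  split=> [i|i|]; [by case: fintype.split | by case: fintype.split |].
  rewrite big_split_ord; congr (_ + _); apply: eq_bigr => i _.
    by rewrite -[lshift _ _]/(unsplit (inl i)) unsplitK.
  by rewrite -[rshift _ _]/(unsplit (inr i)) unsplitK.
- move=> r _ Ar [m [a [b [Ia Jb ->]]]].
  exists m, (fun i => r * a i), b; split=> [i||]; [exact: IM | by [] |].
  by rewrite mulr_sumr; apply: eq_bigr => i _; rewrite mulrA.
Qed.

Lemma set_mulS (I I' J : set F) :
  I `<=` I' -> set_mul I J `<=` set_mul I' J.
Proof.
by move=> II _ [m [a [b [Ia Jb ->]]]]; exists m, a, b; split=> // i; apply: II.
Qed.

Lemma set_mul_prod (I J : set F) x y : I x -> J y -> set_mul I J (x * y).
Proof.
by move=> Ix Jy; exists 1%N, (fun=> x), (fun=> y); split=> //; rewrite big_ord1.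
Qed.

Lemma residual_codom_span n (g : 'I_n -> F) X x y : is_submodule A X ->
  residual (codom g) X x -> span_set A g y -> X (x * y).
Proof.
move=> X_mod gx [c Ac ->]; rewrite mulr_sumr; apply: submodule_sum => // i.
by rewrite mulrCA; case: X_mod => _ _; apply=> //; apply/gx/codom_f.
Qed.

Lemma residual_span_subset n (g : 'I_n -> F) t X : is_submodule A X ->
  (forall a, a \in t -> span_set A g a) -> residual (codom g) X `<=` residual t X.
Proof.
by move=> X_mod gt x gx a /gt; apply: (residual_codom_span _ gx).
Qed.

Lemma residual_power_span_subset n (g : 'I_n -> F) t m X : is_submodule A X ->
  (forall a, a \in t -> span_set A g a) ->
  residual_power (codom g) m X `<=` residual_power t m X.
Proof.
move=> X_mod gt; elim: m => //= m IHm x hx.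
apply: (residualS IHm).
by apply: (residual_span_subset _ gt); last exact: hx;
  apply: residual_power_submodule.
Qed.

Lemma residual_power_exp n (g : 'I_n -> F) m x p :
  residual_power (codom g) m A x -> set_exp A (span_set A g) m p -> A (x * p).
Proof.
elim: m x p => [|m IHm] x p; first exact: subring_setM.
move=> gx [k [a [b [Ia Jb ->]]]]; rewrite mulr_sumr.
apply: submodule_sum; first exact: subring_is_submodule.
move=> i; rewrite mulrA; apply: IHm (Jb i).
apply: residual_codom_span (Ia i) => //.
exact: residual_power_submodule subring_is_submodule.
Qed.

(* [u] lists the products of [m] members of [t]. *)
Lemma exp_generators t I m : (forall a, a \in t -> I a) ->
  exists2 u : seq F, forall p, p \in u -> set_exp A I m p &
    residual u A `<=` residual_power t m A.
Proof.
move=> tI; elim: m => [|m [u uI uR]].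
  exists [:: 1] => [p|x]; last by move/(_ 1); rewrite mulr1; apply; rewrite inE.
  by rewrite inE => /eqP ->; apply: subring_set1.
exists [seq a * b | a <- t, b <- u] => [p|x hx a ta].
  by case/allpairsP=> -[a b] /= [ta ub ->];
    apply: set_mul_prod; [apply: tI | apply: uI].
by apply: uR => b ub; rewrite -mulrA; apply: hx; apply: allpairs_f.
Qed.

Lemma mul_exp_generators s t I J m :
  (forall a, a \in s -> J a) -> (forall a, a \in t -> I a) ->
  exists2 u : seq F, forall p, p \in u -> set_mul J (set_exp A I m) p &
    residual u A `<=` residual s (residual_power t m A).
Proof.
move=> sJ tI; have [u uI uR] := exp_generators m tI.
exists [seq a * b | a <- s, b <- u] => [p|x hx a ta].
  by case/allpairsP=> -[a b] /= [sa ub ->];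
    apply: set_mul_prod; [apply: sJ | apply: uI].
by apply: uR => b ub; rewrite -mulrA; apply: hx; apply: allpairs_f.
Qed.


(** * The $t$-operation and $t$-basicness in terms of residuals *)

Hypothesis A_frac : quotient_field A = setT.

Lemma frac_invE I x : frac_inv A I x <-> forall y, I y -> A (x * y).
Proof. by split=> [[]//|h]; split=> //; rewrite A_frac. Qed.

Lemma v_closureE n (g : 'I_n -> F) x :
  v_closure A (span_set A g) x <->
  forall y, residual (codom g) A y -> A (x * y).
Proof.
split=> [/frac_invE h y gy|h].
  apply/h/frac_invE => z gz.
  exact: (residual_codom_span subring_is_submodule gy gz).
apply/frac_invE => y /frac_invE gy; apply: h => a /codomP[i ->].
exact/gy/mem_span_set.
Qed.

Lemma codom_exists (s : seq F) : exists n (g : 'I_n -> F), codom g = s.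
Proof.
exists (size s), (tnth (in_tuple s)).
by rewrite /codom /image_mem map_tnth_enum.
Qed.

Lemma t_closureP I x : is_submodule A I ->
  t_closure A I x <-> exists u : seq F,
    [/\ forall a, a \in u -> I a, has (fun a => a != 0) u &
        forall y, residual u A y -> A (x * y)].
Proof.
move=> I_mod; split.
  case=> _ [[n [g ->]] [z gz z0] gI] /v_closureE h; exists (codom g); split=> //.
    by move=> a /codomP[i ->]; apply/gI/mem_span_set.
  (* If all generators vanished, so would the nonzero element [z] of their span. *)
  apply: contraNT z0 => /hasPn g0; case: gz => c _ ->.
  rewrite big1 // => i _.
  by have /negPn/eqP -> := g0 _ (codom_f g i); rewrite mulr0.
case=> u [uI /hasP[a ua a0] h].
have [n [g gu]] := codom_exists u; move: uI ua h; rewrite -gu => uI ua h.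
exists (span_set A g); last by apply/v_closureE.
have gI i : I (g i) by apply/uI/codom_f.
split; [by exists n, g | | exact: span_set_min].
by case/codomP: ua => i ai; exists a => //; rewrite ai; apply: mem_span_set.
Qed.

(** The witness is the submodule generated by [x], which has to be nonzero to count in the
    $t$-closure. *)
Lemma mem_t_closure I x : is_submodule A I -> I x -> x != 0 -> t_closure A I x.
Proof.
move=> I_mod Ix x0; apply/t_closureP => //; exists [:: x].
split=> [a||y]; [by rewrite inE => /eqP -> | by rewrite /= x0 |].
by move/(_ x); rewrite mulrC inE; apply.
Qed.

Lemma common_denominator (s : seq F) :
  exists2 d, d != 0 & A d /\ forall a, a \in s -> A (d * a).
Proof.
elim: s => [|a s [d d0 [Ad ds]]]; first exists 1.
- exact: oner_neq0.
- by split=> //; apply: subring_set1.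
have : quotient_field A a by rewrite A_frac.
case=> b [c [Ab Ac c0 ->]]; exists (d * c); first exact: mulf_neq0.
split=> [|x]; first exact: subring_setM.
rewrite inE => /predU1P[->|/ds Adx].
  by rewrite -mulrA [c * _]mulrC divfK //; apply: subring_setM.
by rewrite mulrAC; apply: subring_setM.
Qed.

Lemma set_exp_submodule I m : is_submodule A I -> is_submodule A (set_exp A I m).
Proof.
move=> I_mod; case: m => [|m]; first exact: subring_is_submodule.
exact: set_mul_submodule.
Qed.


Lemma t_closureS I J : is_submodule A I -> is_submodule A J ->
  J `<=` I -> t_closure A J `<=` t_closure A I.
Proof.
move=> I_mod J_mod JI x /t_closureP -/(_ J_mod)[u [uJ u0 ux]].
by apply/t_closureP => //; exists u; split=> // a /uJ /JI.
Qed.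

(** The inclusion of residuals makes the ideal $J$ spanned by [s] a $t$-reduction of the ideal $I$
    spanned by [t]. Then each generator of $I$ lies in $J_t$, so $J^{-1}$ multiplies it into [A]. *)
Lemma residual_basic_of_finite_t_basic :
  finite_t_basic_ideal_property A -> residual_basic A.
Proof.
move=> ftb s t n st s0 h; have [d d0 [_ tA]] := common_denominator t.
(* By homogeneity a common denominator of [t] can be absorbed, so that [s] and [t] generate ideals
   inside [A]. *)
apply: (residual_subset_scale d0).
have {h} := residual_basic_scale d0 h.
have : {subset [seq d * a | a <- s] <= [seq d * a | a <- t]}.
  by move=> _ /mapP[a /st ta ->]; apply: map_f.
have : has (fun a => a != 0) [seq d * a | a <- s].
  by rewrite has_map; apply: sub_has s0 => a a0 /=; rewrite mulf_neq0.
have : forall a, a \in [seq d * a | a <- t] -> A a.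
  by move=> _ /mapP[a /tA ta ->].
move: [seq d * a | a <- s] [seq d * a | a <- t] => {d d0 tA st s0} {}s {}t.
move=> tA /hasP[z sz z0] st h y sy c tc.
have [-> | c0] := eqVneq c 0; first by rewrite mulr0; apply: subring_set0.
have [k [g gt]] := codom_exists t; have [l [f fs]] := codom_exists s.
have [I_mod J_mod] := (span_set_submodule g, span_set_submodule f).
have tI a : a \in t -> span_set A g a.
  by rewrite -gt => /codomP[i ->]; apply: mem_span_set.
have sJ a : a \in s -> span_set A f a.
  by rewrite -fs => /codomP[i ->]; apply: mem_span_set.
have JI : span_set A f `<=` span_set A g.
  by apply: span_set_min => // i; apply/tI/st; rewrite -fs codom_f.
have IA : span_set A g `<=` A.
  apply: span_set_min => [|i]; first exact: subring_is_submodule.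
  by apply: tA; rewrite -gt codom_f.
have JA : span_set A f `<=` A by apply: subset_trans IA.
have nzJ : nonzero_set (span_set A f) by exists z; rewrite ?z0 //; apply: sJ.
have Ic : t_closure A (span_set A g) c by apply: mem_t_closure => //; apply: tI.
have : t_closure A (span_set A f) c.
  rewrite (ftb (span_set A g)) //; first by exists z => //; apply/JI/sJ.
    by exists k, g.
  split=> //; exists n; have Im_mod m := set_exp_submodule m I_mod.
  apply/seteqP; split.
    apply: t_closureS; [exact: Im_mod | exact: set_mul_submodule |].
    exact: set_mulS.
  move=> x /t_closureP -/(_ (Im_mod _))[u [uI u0 ux]].
  have [v vJ vR] := mul_exp_generators n sJ tI.
  apply/t_closureP; first exact: set_mul_submodule.
  (* The power of [z] lies in $JI^n$ and supplies the nonzero member that [t_closureP] requires. *)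
  exists (z ^+ n.+1 :: v); split=> [a||w hw].
  - rewrite inE => /predU1P[->|/vJ//].
    rewrite exprS; apply: set_mul_prod; first exact: sJ.
    elim: n {h Im_mod uI v vJ vR} => [|n IHn]; first exact: subring_set1.
    by rewrite exprS; apply: set_mul_prod => //; apply/JI/sJ.
  - by rewrite /= expf_neq0.
  (* An element of the residual of [v] lies in $(JI^n)^{-1}$, hence by [h] in $(I^{n+1})^{-1}$. *)
  - apply: ux => a /uI Ia; apply: residual_power_exp Ia; rewrite gt.
    by apply/h/vR => b vb; apply: hw; rewrite inE vb orbT.
case/t_closureP => // u [uJ u0 uc]; rewrite mulrC; apply: uc => a /uJ Ja.
by apply: (residual_codom_span subring_is_submodule _ Ja); rewrite fs.
Qed.

(** Each member of [q] involves only finitely many elements of [J]; concatenating these sequences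
    gives one that serves all of [q]. This extracts a finite part of an ideal [J] that may not be
    finitely generated. *)
Lemma residual_collect J Y (q : seq F) :
  (forall p, p \in q -> exists2 s : seq F, forall a, a \in s -> J a &
     forall x, residual s Y x -> A (x * p)) ->
  exists2 s : seq F, forall a, a \in s -> J a & residual s Y `<=` residual q A.
Proof.
elim: q => [|p q IHq] h; first by exists [::].
have [p' qp'|s sJ sq] := IHq; first by apply: h; rewrite inE qp' orbT.
have [|s' s'J s'p] := h p; first exact: mem_head.
exists (s' ++ s) => [a|x hx a].
  by rewrite mem_cat => /orP[/s'J|/sJ].
rewrite inE => /predU1P[->|qa].
  by apply: s'p => b s'b; apply: hx; rewrite mem_cat s'b.
by apply: sq qa => b sb; apply: hx; rewrite mem_cat sb orbT.
Qed.

(** The finitely many products generating $I^{n+1}$ lie in $(JI^n)_t$, which involves only finitely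
    many elements of $J$. The ideal they generate already satisfies the reduction condition, so its
    inverse lies in $I^{-1}$. *)
Lemma finite_t_basic_of_residual_basic :
  residual_basic A -> finite_t_basic_ideal_property A.
Proof.
move=> rb I [I_mod _] _ [k [g Ig]] J [[J_mod _] [z Jz z0] JI [n e]].
set Y := residual_power (codom g) n A.
(* Only the factors from $J$ need recording: those from $I^n$ are absorbed by [Y], which is $(A :
   I^n)$. *)
have prodP w : set_mul J (set_exp A I n) w ->
    exists2 s : seq F, forall a, a \in s -> J a &
      forall x, residual s Y x -> A (x * w).
  move=> [m [a [b [Ja Ib ->]]]]; exists (codom a) => [_ /codomP[i ->] //|x hx].
  rewrite mulr_sumr; apply: submodule_sum subring_is_submodule _ => i.
  by rewrite mulrA; apply: residual_power_exp; [apply/hx/codom_f | rewrite -Ig].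
have gI a : a \in codom g -> I a.
  by rewrite Ig => /codomP[i ->]; apply: mem_span_set.
have [q qI qR] := exp_generators n.+1 gI.
have [p qp|s sJ sR] := @residual_collect J Y q.
  have [->|p0] := eqVneq p 0.
    by exists [::] => // x _; rewrite mulr0; apply: subring_set0.
  have : t_closure A (set_exp A I n.+1) p.
    by apply: mem_t_closure => //; [apply: set_exp_submodule | apply: qI].
  (* Finitely many elements [u] of $JI^n$ witness that [p] is in $(JI^n)_t$, and each of them uses
     finitely many elements of $J$; hence the nested use of [residual_collect]. *)
  rewrite -e => /t_closureP -/(_ (set_mul_submodule _ J_mod))[u [uJ _ up]].
  have [w /uJ /prodP//|s sJ su] := @residual_collect J Y u.
  by exists s => // x /su /up; rewrite mulrC.
have zsJ a : a \in z :: s -> J a by rewrite inE => /predU1P[->|/sJ].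
have R_g : residual (z :: s) A `<=` residual (codom g) A.
  (* Adding [z] makes the smaller sequence nonzero; prepending it all to [codom g] gives the
     required inclusion and still generates $I$. *)
  have := rb (z :: s) ((z :: s) ++ codom g) n; rewrite /= z0 => /(_ _ isT) h.
  apply: subset_trans (h _ _) _ => [a za|x hx|].
  - by rewrite -cat_cons mem_cat za.
  - apply: (@residual_power_span_subset _ g _ n.+1 A subring_is_submodule).
      by move=> a; rewrite -Ig -cat_cons mem_cat => /orP[/zsJ /JI|/gI].
    apply/qR/sR => a sa; apply: residual_power_subset; last first.
      by apply: hx; rewrite inE sa orbT.
    by move=> b gb; rewrite -cat_cons mem_cat gb orbT.
  - by apply: residual_subset => a ga; rewrite -cat_cons mem_cat ga orbT.
apply/seteqP; split; first exact: t_closureS.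
move=> x /t_closureP -/(_ I_mod)[u [uI _ ux]]; apply/t_closureP => //.
exists (z :: s); split=> [||y /R_g gy]; [exact: zsJ | by rewrite /= z0 |].
apply: ux => a /uI; rewrite Ig.
exact: (residual_codom_span subring_is_submodule gy).
Qed.

Lemma finite_t_basic_ideal_propertyP :
  finite_t_basic_ideal_property A <-> residual_basic A.
Proof.
split; [exact: residual_basic_of_finite_t_basic |
        exact: finite_t_basic_of_residual_basic].
Qed.

End Subring.

(** * Units of a local ring and the quotient field of $T$ *)

Lemma local_ring_unit (E : comNzRingType) (M : set E) (x : E) :
  local_with_maximal_ideal setT M -> ~ M x -> exists y, x * y = 1.
Proof.
move=> [_ M_unique] xM; apply: contrapT => x_nonunit; apply: xM.
pose P (X : set E) := X = set0 \/ [/\ is_ideal setT X, X x & ~ X 1].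
have [C CP|N [PN N_max]] := @Zorn_bigcup E P.
  move=> C_total.
  have [[X CX [a Xa]]|C0] := pselect (exists2 X, C X & X !=set0); last first.
    left; apply/seteqP; split=> // a [X CX Xa].
    by apply: C0; exists X => //; exists a.
  right; have Pne Y b : C Y -> Y b -> [/\ is_ideal setT Y, Y x & ~ Y 1].
    by move=> /CP[-> //|].
  have [[[X0 _ _] _] Xx _] := Pne _ _ CX Xa.
  split; [split=> //; split | by exists X |].
  - by exists X.
  - move=> b c [Y CY Yb] [Z CZ Zc].
    have [[[_ YD _] _] _ _] := Pne _ _ CY Yb.
    have [[[_ ZD _] _] _ _] := Pne _ _ CZ Zc.
    by case: (C_total Y Z CY CZ) => [YZ|ZY];
      [exists Z => //; apply: ZD => //; apply: YZ
      |exists Y => //; apply: YD => //; apply: ZY].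
  - move=> r b _ [Y CY Yb]; exists Y => //.
    by have [[[_ _ YM] _] _ _] := Pne _ _ CY Yb; apply: YM.
  - by move=> [Y CY Y1]; have [_ _] := Pne _ _ CY Y1.
have xT_P : P [set x * y | y in setT].
  right; split; last by move=> [y _ xy1]; apply: x_nonunit; exists y.
    split=> //; split; first by exists 0; rewrite ?mulr0.
      by move=> _ _ [y _ <-] [z _ <-]; exists (y + z); rewrite ?mulrDr.
    by move=> a _ _ [y _ <-]; exists (a * y) => //; rewrite mulrCA.
  by exists 1; rewrite ?mulr1.
have [N0|[N_ideal Nx N1]] := PN.
  case: (N_max _ _ xT_P); rewrite N0; split=> // sub.
  by apply: (sub x); exists 1; rewrite ?mulr1.
suff -> : M = N by [].
apply/esym/M_unique; split=> //; first by split=> // /(_ 1 I).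
move=> J J_ideal NJ [_ J_proper]; apply/seteqP; split=> //.
apply: contrapT => JN; apply: (N_max J); first by split.
right; split=> // [|J1]; first exact: NJ.
have [[_ _ JM] _] := J_ideal.
by apply: J_proper => y _; rewrite -[y]mulr1; apply: JM.
Qed.

Lemma fraction_quotient_field (T : idomainType) :
  quotient_field (in_frac [set: T]) = setT.
Proof.
apply/seteqP; split=> // + _; elim/quotW => -[[n d] /= d0].
exists (FracField.tofrac n), (FracField.tofrac d).
split; [by exists n | by exists d | by rewrite tofrac_eq0 |].
apply: (canRL (mulfK _)); first by rewrite tofrac_eq0.
rewrite !piE; apply/eqmodP.
rewrite /= FracField.equivfE /FracField.mulf /=.
by rewrite !numden_Ratio /= ?mulf_neq0 ?oner_eq0 // !mulr1 mulrC.
Qed.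

(** * Residuals over $R$, $T$ and $M$ in the pullback square *)

Section Pullback.
Variables (T : idomainType) (K : fieldType) (phi : {rmorphism T -> K}).
Hypothesis phi_surj : forall z : K, exists x : T, phi x = z.
Hypothesis phi_unit : forall x : T, phi x != 0 -> exists y, x * y = 1.

Local Notation tofrac := (@FracField.tofrac T).
Implicit Types (Y : set K).

(* The rings T, R and the ideal M, as subsets of the quotient field of T, are *)
(* [pullback setT], [pullback D] and [pullback [set 0]]. *)
Definition pullback Y : set {fraction T} := in_frac (phi @^-1` Y).

Local Notation TF := (pullback setT).
Local Notation MF := (pullback [set 0]).

Lemma mem_pullback Y x : pullback Y (tofrac x) <-> Y (phi x).
Proof.
split=> [[y Yy /eqP]|Yx]; last by exists x.
by rewrite tofrac_eq => /eqP <-.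
Qed.

Lemma pullbackS Y Y' : Y `<=` Y' <-> pullback Y `<=` pullback Y'.
Proof.
split=> [YY _ [x Yx <-]|YY z]; first exact/mem_pullback/YY.
by have [x <-] := phi_surj z; move=> /mem_pullback/YY/mem_pullback.
Qed.

Lemma pullback_subring Y :
  GRing.subring_closed [in Y] -> GRing.subring_closed [in pullback Y].
Proof.
move=> Y_subring; split; rewrite ?inE.
- by rewrite -tofrac1; apply/mem_pullback; rewrite rmorph1; apply: subring_set1.
- move=> x y; rewrite !inE => -[a Ya <-] [b Yb <-].
  by rewrite -tofracB; apply/mem_pullback; rewrite rmorphB; apply: subring_setB.
- move=> x y; rewrite !inE => -[a Ya <-] [b Yb <-].
  by rewrite -tofracM; apply/mem_pullback; rewrite rmorphM; apply: subring_setM.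
Qed.

Lemma setT_subring (F : fieldType) : GRing.subring_closed [in [set: F]].
Proof. by split=> [|x y _ _|x y _ _]; apply/mem_set. Qed.

Let T_subring := pullback_subring (@setT_subring K).

Lemma pullback0_ideal x y : TF x -> MF y -> MF (x * y).
Proof.
move=> [a _ <-] [b b0 <-]; rewrite -tofracM; apply/mem_pullback.
by rewrite /= rmorphM b0 mulr0.
Qed.

Lemma pullback_unit x : TF x -> ~ MF x -> x != 0 /\ TF x^-1.
Proof.
move=> [a _ <-] /mem_pullback/eqP/phi_unit[b ab].
have a0 : a != 0 by apply: contra_eq_neq ab => ->; rewrite mul0r eq_sym oner_eq0.
rewrite tofrac_eq0; split=> //; exists b => //.
apply: (mulfI (x := tofrac a)); first by rewrite tofrac_eq0.
by rewrite -tofracM ab tofrac1 divff ?tofrac_eq0.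
Qed.

Lemma not_pullback0_1 : ~ MF 1.
Proof.
by rewrite -tofrac1 => /mem_pullback/= /eqP; rewrite rmorph1 oner_eq0.
Qed.

(** If [s] contains a unit [a] of $T$, then $xa \in T$ forces $x \in T$, and the remaining
    conditions can be tested modulo $M$. *)
Lemma residual_pullback (s : seq T) Y : has (fun a => phi a != 0) s ->
  residual (map tofrac s) (pullback Y) = pullback (residual (map phi s) Y).
Proof.
case/hasP=> a sa a0; have [b ab] := phi_unit a0.
apply/seteqP; split=> [x hx|_ [u Yu <-] _ /mapP[c sc ->]]; last first.
  by rewrite -tofracM; apply/mem_pullback; rewrite rmorphM; apply/Yu/map_f.
have : pullback Y (x * tofrac a) by apply/hx/map_f.
case=> u _ xu; have ex : x = tofrac (u * b).
  by rewrite tofracM xu -mulrA -tofracM ab tofrac1 mulr1.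
rewrite ex; apply/mem_pullback => _ /mapP[c sc ->].
by rewrite -rmorphM; apply/mem_pullback; rewrite tofracM -ex; apply/hx/map_f.
Qed.

Lemma residual_power_pullback (s : seq T) n Y : has (fun a => phi a != 0) s ->
  residual_power (map tofrac s) n (pullback Y) =
  pullback (residual_power (map phi s) n Y).
Proof. by move=> su; elim: n => //= n ->; rewrite residual_pullback. Qed.

Lemma seq_tofrac (s : seq {fraction T}) :
  (forall a, a \in s -> TF a) -> exists s', s = map tofrac s'.
Proof.
elim: s => [|a s IHs] sT; first by exists [::].
have [s' ->] : exists s', s = map tofrac s'.
  by apply: IHs => b sb; apply: sT; rewrite inE sb orbT.
by have [|b _ <-] := sT a; [exact: mem_head | exists (b :: s')].
Qed.

(* Over the local ring T, the T-module generated by a finite sequence is       *)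
(* principal if and only if a single member generates it.                      *)
Definition principal_at (s : seq {fraction T}) a :=
  [/\ a \in s, a != 0 & forall b, b \in s -> TF (b / a)].

(** If $xa$ were a unit of $T$ for some [a] in [s], then $b/a = (xb)(xa)^{-1}$ would lie in $T$ for
    every [b] in [s], and [a] would generate. *)
Lemma residual_nonprincipal s : ~ (exists a, principal_at s a) ->
  residual s TF `<=` residual s MF.
Proof.
move=> s_np x hx a sa; apply: contrapT => xaM; apply: s_np; exists a.
have [xa0 xaV] := pullback_unit (hx a sa) xaM.
move: (xa0); rewrite mulf_eq0 negb_or => /andP[x0 a0]; split=> // b sb.
have -> : b / a = (x * b) * (x * a)^-1 by rewrite invfM mulrACA divff ?mul1r.
by apply: (subring_setM T_subring) => //; apply: hx.
Qed.

(** The pullback of [Y] lies between $M$ and $T$, whose residuals coincide. With [Y] equal to $D$,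
    inverses over $R$ and $T$ agree. *)
Lemma residual_nonprincipal_eq s Y : Y 0 -> ~ (exists a, principal_at s a) ->
  residual s (pullback Y) = residual s TF.
Proof.
move=> Y0 s_np; apply/seteqP; split.
  by apply: residualS; apply/pullbackS.
apply: subset_trans (residual_nonprincipal s_np) _.
by apply: residualS; apply/pullbackS => _ ->.
Qed.

(** This normalization puts the sequence inside $T$ with 1 as a member, so that [residual_pullback]
    applies. *)
Lemma principal_scale t a : principal_at t a ->
  exists2 t' : seq T, [seq a^-1 * b | b <- t] = map tofrac t' & 1 \in t'.
Proof.
move=> [ta a0 tT].
have [t' et'] : exists t', [seq a^-1 * b | b <- t] = map tofrac t'.
  by apply: seq_tofrac => _ /mapP[b tb ->]; rewrite mulrC; apply: tT.
exists t' => //; rewrite -(mem_map (f := tofrac)); last first.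
  by move=> x y /eqP; rewrite tofrac_eq => /eqP.
by rewrite -et' tofrac1; apply/mapP; exists a; rewrite ?mulVf.
Qed.

Lemma residual_power_mem1 (F : fieldType) (t : seq F) n X :
  1 \in t -> residual_power t n X `<=` X.
Proof.
move=> t1; elim: n => //= n IHn x hx; apply: IHn.
by rewrite -[x]mulr1; apply: hx.
Qed.

Lemma residual_power_absorb (F : fieldType) (t : seq F) n X :
  (forall x a, X x -> a \in t -> X (x * a)) -> X `<=` residual_power t n X.
Proof.
move=> tX; elim: n => //= n IHn x Xx a ta; exact/IHn/tX.
Qed.

(** * Transfer of basicness between $R$, $T$ and $D$ *)

Section Subring.
Variable D : set K.
Hypothesis D_subring : GRing.subring_closed [in D].

Local Notation RF := (pullback D).

Let D0 : D 0 := subring_set0 D_subring.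

(** Lift generators along a section of [phi]. A nonzero residue lifts to a unit of $T$, so residuals
    over $R$ are preimages of residuals over $D$. *)
Lemma residual_basic_residue : residual_basic RF -> residual_basic D.
Proof.
have [g gK] := choice phi_surj => rb s t n st s0 h.
have phi_g u : map phi (map g u) = u.
  by rewrite -map_comp map_id_in // => a _ /=; rewrite gK.
have unit_g u : has (fun a => a != 0) u -> has (fun a => phi a != 0) (map g u).
  by rewrite has_map; apply: sub_has => a; rewrite /= gK.
have t0 : has (fun a => a != 0) t.
  by case/hasP: s0 => a /st ta a0; apply/hasP; exists a.
have gst : {subset map tofrac (map g s) <= map tofrac (map g t)}.
  by move=> _ /mapP[_ /mapP[a /st ta ->] ->]; rewrite !map_f.
have g0 : has (fun a => a != 0) (map tofrac (map g s)).
  rewrite has_map; apply: sub_has (unit_g _ s0) => a /=.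
  by rewrite tofrac_eq0; apply: contraNneq => ->; rewrite rmorph0.
have := rb _ _ n gst g0.
rewrite !residual_power_pullback ?unit_g // !residual_pullback ?unit_g //.
by rewrite !phi_g => hR; apply/pullbackS/hR/pullbackS.
Qed.

Lemma residual_basic_quotient_field :
  residual_basic RF -> quotient_field D = setT.
Proof.
move=> rb; apply/seteqP; split=> // z _; apply: contrapT => zD.
have [y yz] := phi_surj z.
have R_1 : residual [:: 1] RF 1.
  move=> a; rewrite inE mul1r => /eqP ->.
  exact: subring_set1 (pullback_subring D_subring).
have sub : {subset [:: 1] <= [:: 1; tofrac y]}.
  by move=> a; rewrite !inE => ->.
suff Ry : RF (1 * tofrac y).
  move: Ry; rewrite mul1r => /mem_pullback Dz; apply: zD; exists z, 1.
  by rewrite -yz oner_eq0 divr1; split=> //; apply: subring_set1.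
(* The reduction (1) of $(1, y)$ has exponent one; were it trivial, $1 \in (1)^{-1}$ would give $y
   \in R$. *)
apply: (rb _ _ 1%N sub _ _ 1 R_1); last by rewrite !inE eqxx orbT.
  by rewrite /= oner_eq0.
move=> x hx; have {hx} xt a : a \in [:: 1; tofrac y] -> RF (x * a).
  move=> ta; rewrite -[x]mulr1; apply: hx => //; exact: mem_head.
have [|u Du xu] := xt 1; first exact: mem_head.
rewrite mulr1 in xu.
have Duz : D (phi u * z).
  by rewrite -yz -rmorphM; apply/mem_pullback; rewrite tofracM xu; apply: xt;
    rewrite !inE eqxx orbT.
(* Otherwise [z] would be a quotient of the elements [phi u * z] and [phi u] of $D$. So [x] lies in
   $M$, and its products with members of $(1, y)^2$ stay in $M$. *)
have u0 : phi u = 0.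
  apply: contra_notP zD => /eqP u0; exists (phi u * z), (phi u); split=> //.
  by rewrite mulrC mulKf.
have tT a : a \in [:: 1; tofrac y] -> TF a.
  rewrite !inE => /orP[] /eqP ->; last by exists y.
  exact: subring_set1 T_subring.
have Mx : MF x by rewrite -xu; apply/mem_pullback.
move=> a ta b tb; apply: (iffLR (pullbackS [set 0] D)); first by move=> _ ->.
rewrite [x * a]mulrC [_ * b]mulrC.
by apply: pullback0_ideal; [exact: tT | apply: pullback0_ideal; first exact: tT].
Qed.

Lemma residual_basic_overring : residual_basic RF -> residual_basic TF.
Proof.
(* For exponent zero the hypothesis is the conclusion. A positive exponent provides an innermost
   residual by [t], where $T$ can be exchanged for $R$. *)
move=> rb s t [|n] st s0 h //.
have T_mod := subring_is_submodule T_subring.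
have [[a ta]|t_np] := pselect (exists a, principal_at t a).
  have a0 : a^-1 != 0 by case: ta; rewrite invr_eq0.
  apply: (residual_subset_scale a0) => x.
  have := residual_basic_scale a0 h.
  have [t' -> t'1] := principal_scale ta => {}h.
  have t'T b : b \in map tofrac t' -> TF b by case/mapP=> c _ ->; exists c.
  have TF_t' y b : TF y -> b \in map tofrac t' -> TF (y * b).
    by move=> Ty /t'T; apply: (subring_setM T_subring).
  (* After rescaling, $IT = T$: its powers absorb into $T$, so [h] puts $J^{-1}$ inside $T$. *)
  move=> hx b tb; apply: (TF_t' _ b) => //.
  apply: (@residual_power_mem1 _ (map tofrac t') n.+2).
    by rewrite -tofrac1 map_f.
  apply: h => c /hx xc; exact: (residual_power_absorb n.+1 TF_t' xc).
have tR : residual t RF = residual t TF by apply: residual_nonprincipal_eq.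
move: h; rewrite !residual_powerSr -tR -!residual_powerSr => h.
have [[a [sa a0 aT]]|s_np] := pselect (exists a, principal_at s a); last first.
  have := rb s t n.+1 st s0 h.
  by rewrite !residual_nonprincipal_eq.
(* When $JT = aT$, replace $J$ by the $R$-module generated by [a]. The reduction condition survives
   because the residual powers involved are $T$-modules. Basicness over $R$ then gives $a^{-1} \in
   I^{-1}$, and nonprincipality of $IT$ puts $1 = a^{-1}a$ in $M$. *)
have a_t : {subset [:: a] <= t} by move=> b; rewrite inE => /eqP ->; apply: st.
have a1 : residual t RF a^-1.
  apply: (rb [:: a] t n.+1 a_t); first by rewrite /= a0.
    apply: subset_trans _ h => x xa b sb.
    rewrite -[b](divfK a0) mulrCA.
    have := residual_power_submodule t n.+1 T_mod.
    rewrite residual_powerSr -tR -residual_powerSr => -[_ _ TM].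
    by apply: TM; [exact: aT | exact/xa/mem_head].
  move=> b; rewrite inE => /eqP ->; rewrite mulVf //.
  exact: subring_set1 (pullback_subring D_subring).
rewrite tR in a1; case: not_pullback0_1; rewrite -(mulVf a0).
by apply: (residual_nonprincipal t_np a1); apply: st.
Qed.

Lemma residual_basic_pullback :
  D `<` setT -> residual_basic TF -> residual_basic D -> residual_basic RF.
Proof.
move=> [_ D_proper] rbT rbD s t n st s0 h.
have RT : RF `<=` TF by apply/pullbackS.
have [[a ta]|t_np] := pselect (exists a, principal_at t a); last first.
  case: n h => [//|n]; rewrite !residual_powerSr.
  have tR : residual t RF = residual t TF by apply: residual_nonprincipal_eq.
  rewrite tR -!residual_powerSr => h.
  (* Only $I^{-1}$ must agree over $R$ and $T$; for $J$ the inclusion of the inverse over $R$ in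
     that over $T$ suffices, even if $JT$ is principal. *)
  by apply: subset_trans (rbT s t n.+1 st s0 h); apply: residualS.
have a0 : a^-1 != 0 by case: ta; rewrite invr_eq0.
apply: (residual_subset_scale a0).
have := residual_basic_scale a0 h.
have : {subset [seq a^-1 * b | b <- s] <= [seq a^-1 * b | b <- t]}.
  by move=> _ /mapP[b /st tb ->]; apply: map_f.
have [t' -> t'1] := principal_scale ta => sub.
have [s' es] : exists s', [seq a^-1 * b | b <- s] = map tofrac s'.
  by apply: seq_tofrac => b /sub /mapP[c _ ->]; exists c.
rewrite {}es in sub *.
have {}sub : {subset s' <= t'}.
  move=> b s'b; have /mapP[c t'c /eqP] := sub _ (map_f tofrac s'b).
  by rewrite tofrac_eq => /eqP ->.
have t'u : has (fun a => phi a != 0) t'.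
  by apply/hasP; exists 1; rewrite // rmorph1 oner_eq0.
(* If [s'] contains a unit of $T$, all residuals are pullbacks and the condition descends to $D$. *)
have [s'u|s'0] := boolP (has (fun a => phi a != 0) s').
  rewrite !residual_power_pullback // !residual_pullback //.
  move=> /pullbackS hD; apply/pullbackS; apply: (rbD _ _ n) hD.
    by move=> _ /mapP[b /sub tb ->]; apply: map_f.
  by rewrite has_map.
(* Otherwise the smaller ideal lies in M, and so do its products, whose inverse *)
(* thus contains T; but the inverse of an ideal containing 1 lies in R.         *)
move=> {}h; case: D_proper => z _; have [y <-] := phi_surj z.
apply/mem_pullback; apply: (@residual_power_mem1 _ (map tofrac t') n.+1).
  by rewrite -tofrac1 map_f.
apply: h => _ /mapP[b s'b ->].
have : residual_power (map tofrac t') n MF (tofrac y * tofrac b).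
  apply: residual_power_absorb.
    move=> x _ Mx /mapP[c _ ->]; rewrite mulrC.
    by apply: pullback0_ideal => //; exists c.
  apply: pullback0_ideal; first by exists y.
  apply/mem_pullback/eqP/negPn; exact: (hasPn s'0).
by apply: residual_powerS; apply/pullbackS => _ ->.
Qed.

End Subring.
End Pullback.

Theorem theorem4p2 (T : idomainType) (M : set T)
    (T_local : local_with_maximal_ideal [set: T] M)
    (K : fieldType) (phi : {rmorphism T -> K})
    (phi_surj : forall z : K, exists x : T, phi x = z)
    (phi_ker : forall x : T, phi x = 0 <-> M x)
    (D : set K)
    (D_subring : GRing.subring_closed [in D])
    (D_proper : D `<` [set: K])
    (R : set T)
    (R_def : R = phi @^-1` D)
    (RT_quotient_field :
       quotient_field (in_frac R) = quotient_field (in_frac [set: T])) :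
  finite_t_basic_ideal_property (in_frac R) <->
  [/\ finite_t_basic_ideal_property (in_frac [set: T]),
      finite_t_basic_ideal_property D &
      quotient_field D = [set: K]].
Proof.
have phi_unit x : phi x != 0 -> exists y, x * y = 1.
  by move=> x0; apply: (local_ring_unit T_local) => /phi_ker /eqP; apply/negP.
have T_frac := fraction_quotient_field T.
have R_subring := pullback_subring phi D_subring.
have T_subring := pullback_subring phi (setT_subring K).
move: RT_quotient_field; rewrite R_def T_frac => R_frac.
rewrite -/(pullback phi D) -[[set: T]]/(phi @^-1` setT) -/(pullback phi setT).
have RP := finite_t_basic_ideal_propertyP R_subring R_frac.
have TP := finite_t_basic_ideal_propertyP T_subring T_frac.
have DP := finite_t_basic_ideal_propertyP D_subring.
split=> [/RP rb|[/TP rbT ftbD D_frac]].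
  (* This comes first because [DP] still takes the equality of the quotient field of [D] with [K] as
     a hypothesis. *)
  have D_frac := residual_basic_quotient_field phi_surj D_subring rb.
  split=> //.
    exact/TP/(residual_basic_overring phi_surj phi_unit D_subring rb).
  by apply/DP => //; apply: residual_basic_residue rb.
by apply/RP/residual_basic_pullback => //; apply/DP.
Qed.
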